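(* Let $m\ge1$ and let $Q_m$ be the generalized quaternion group generated by $a,b$ with relations $a^{4m}=e$, $b^2=a^{2m}$, $ba=a^{-1}b$. The saturated subsets of $Q_m$ are: - $\{a^{2m},a^{2r}\}$ where $2r$ and $2m$ have different multiplicities of $2$, or $2r\equiv0\pmod{4m}$; - $\{a^{2m},ba^{r}\}$; - $\{e,a^{2r}\}$ where $\frac{2r}{\gcd(2m,2r)}$ is even; - $\{a^{2r},a^{2s}\}$ where $2r,2s\not\equiv 0,2m\pmod{4m}$, $2r$ and $2s$ have the same multiplicity of $2$, and this multiplicity is different from that of $2m$; - $A\cup B$, $A\cup C$, $B\cup C$, where $A=\{a,a^3,\ldots,a^{4m-1}\}$, $B=\{b,ba^2,\ldots,ba^{4m-2}\}$, $C=\{ba,ba^3,\ldots,ba^{4m-1}\}$.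
   Context: For a group $S$, a subset $U\subseteq S$ is avoidable if there is a partition $\{A',B'\}$ of $S$ such that no element of $U$ equals $xy$ with $x\neq y$ both in $A'$ or both in $B'$ (in either order). A subset is saturated if it is maximal with respect to inclusion among the avoidable subsets. Elements of $Q_m$ are written uniquely as $a^x$ or $ba^x$ with $x\in\mathbb{Z}/4m\mathbb{Z}$.
   Formalization: The printed list omits the saturated pairs {a^{2m}, a^{2r+1}} (e.g. {a^2, a} for m=1); the formal list adds them. It also requires 2r≢0 (mod 4m) in the third family and 2r≢2s (mod 4m) in the fourth, so that these are genuine two-element sets. *)

(* Defs.v *)
From HB Require Import structures.
From mathcomp Require Import all_boot all_fingroup.

Set Implicit Arguments.
Unset Strict Implicit.
Unset Printing Implicit Defensive.

Local Open Scope group_scope.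

(* The two blocks of the partition are distinct and, as always for [partition],
   nonempty. As x and y range over ordered pairs, both x * y and y * x are
   excluded from U. *)
Definition avoidable (gT : finGroupType) (U : {set gT}) : bool :=
  [exists A : {set gT}, exists B : {set gT},
    [&& A != B, partition [set A; B] [set: gT]
      & [forall x, forall y,
          (x != y) && ((x \in A) && (y \in A) || (x \in B) && (y \in B))
          ==> (x * y \notin U)]]].

Definition saturated (gT : finGroupType) (U : {set gT}) : bool :=
  maxset (@avoidable gT) U.

(* gT is the group Q_m and a, b are its distinguished generators. Any finite
   group generated by elements satisfying the relations of a presentation is a
   quotient of the presented group, so the last condition together with the
   others fixes (gT, a, b) up to a unique isomorphism. *)
Definition generalized_quaternion (m : nat) (gT : finGroupType) (a b : gT) :
    Prop :=
  [/\ <<[set a; b]>> = [set: gT],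
      [/\ a ^+ (4 * m) = 1, b ^+ 2 = a ^+ (2 * m) & b * a = a^-1 * b]
    & [set: gT] \isog
        Grp (x : y : x ^+ (4 * m) = 1, y ^+ 2 = x ^+ (2 * m), y * x = x^-1 * y)].

Definition odd_rotations (m : nat) (gT : finGroupType) (a : gT) : {set gT} :=
  [set a ^+ (2 * i + 1) | i : 'I_(2 * m)].

Definition even_reflections (m : nat) (gT : finGroupType) (a b : gT) :
    {set gT} :=
  [set b * a ^+ (2 * i) | i : 'I_(2 * m)].

Definition odd_reflections (m : nat) (gT : finGroupType) (a b : gT) :
    {set gT} :=
  [set b * a ^+ (2 * i + 1) | i : 'I_(2 * m)].

(* Main.v *)
(* Avoidability of U means that the graph joining x <> y whenever x y or y x is
   in U is bipartite.  Writing elements as a^x or b a^x with x in Z/4m, and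
   M = 2m, a 2-colouring is a pair of functions f, g on Z/4m; a^k in U asks
   f (k - x) <> f x (when 2x <> k) and g (x + k + M) <> g x (when k <> M), and
   b a^c in U asks g (c + x) = g (c - x) <> f x.  Odd cycles show that a set
   containing an even power of a is avoidable only if it has at most two
   elements, and comparing the translations by k + 2m, l + 2m and 4m shows that
   the pair a^k, a^l with k, l <> M needs the multiplicities of 2 in k + 2m and
   l + 2m to be equal and at most that of 2m.  Conversely f exists because a
   union of two matchings is bipartite, and g is a binary digit.  An avoidable
   set without even powers of a lies in the complement of a subgroup of index 2. *)
Require Import Defs.
From mathcomp Require Import all_boot all_algebra all_fingroup.
From mathcomp Require Import zify ring.

Set Implicit Arguments.
Unset Strict Implicit.
Unset Printing Implicit Defensive.

(** * Translations that flip or fix a Boolean function, and multiplicities of 2 *)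

Section Translations.
Import GRing.Theory.
Local Open Scope ring_scope.

Lemma translate_mul (V : nmodType) (F : V -> bool) (s : bool) (y : V) :
    (forall x, F (x + y) = s (+) F x) ->
  forall n x, F (x + y *+ n) = (odd n && s) (+) F x.
Proof.
move=> Fy; elim=> [|n IHn] x; first by rewrite addr0.
by rewrite mulrSr addrA Fy IHn /=; case: (s) (odd n) (F x) => [] [] [].
Qed.

Variables (R : pzSemiRingType) (F : R -> bool).

(** The least common multiple of [s] and [t] is an iterate of both translations, and the two signs
    it receives must agree. *)
Lemma translate_parity (s t : nat) (p q : bool) :
    (forall x, F (x + s%:R) = p (+) F x) ->
    (forall x, F (x + t%:R) = q (+) F x) ->
  (odd (t %/ gcdn s t) && p) = (odd (s %/ gcdn s t) && q).
Proof.
move=> /translate_mul Fs /translate_mul Ft.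
have := Fs (t %/ gcdn s t)%N 0; rewrite -mulrnA muln_divCA_gcd mulrnA Ft.
by case: (F 0) => /=; do 2!case: (_ && _).
Qed.

Lemma logn2_odd n : odd n -> logn 2 n = 0%N.
Proof. by move=> n_odd; rewrite logn_coprime // coprime2n. Qed.

Lemma logn2_even n : (0 < n)%N -> ~~ odd n -> (0 < logn 2 n)%N.
Proof. by move=> n_gt0 n_even; rewrite logn_gt0 mem_primes n_gt0 dvdn2. Qed.

Lemma logn2_split (s g : nat) :
  (0 < s)%N -> (g %| s)%N -> logn 2 s = (logn 2 g + logn 2 (s %/ g))%N.
Proof.
move=> s_gt0 g_s; have g_gt0 := dvdn_gt0 s_gt0 g_s.
have q_gt0 : (0 < s %/ g)%N by rewrite divn_gt0 ?g_gt0 // (dvdn_leq s_gt0).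
by rewrite -lognM // mulnC divnK.
Qed.

Lemma logn2_exact v q : odd q -> logn 2 (q * 2 ^ v) = v.
Proof.
move=> q_odd; have q_gt0 := odd_gt0 q_odd.
by rewrite lognM ?expn_gt0 // pfactorK // logn2_odd.
Qed.

Lemma logn2_double n : (0 < n)%N -> logn 2 (2 * n) = (logn 2 n).+1.
Proof. by move=> n_gt0; rewrite lognM. Qed.

Lemma logn2_decomp n : (0 < n)%N -> exists2 q, odd q & n = (q * 2 ^ logn 2 n)%N.
Proof.
move=> n_gt0; have [q] := @pfactor_coprime 2 n isT n_gt0.
by rewrite coprime2n; exists q.
Qed.

Lemma logn2_add_lt a b :
  (0 < a)%N -> (logn 2 a < logn 2 b)%N -> logn 2 (a + b) = logn 2 a.
Proof.
move=> a_gt0 ab; have b_gt0 : (0 < b)%N by case: b ab => [|//]; rewrite logn0.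
have [p p_odd aE] := logn2_decomp a_gt0; have [q q_odd bE] := logn2_decomp b_gt0.
rewrite {1}aE bE -(subnKC (ltnW ab)) expnD mulnCA (mulnC p) -mulnDr mulnC.
by rewrite logn2_exact // oddD p_odd oddM oddX subn_eq0 leqNgt ab andbF.
Qed.

Lemma logn2_add_eq a b : (0 < a)%N -> (0 < b)%N -> logn 2 a = logn 2 b ->
  (logn 2 a < logn 2 (a + b))%N.
Proof.
move=> a_gt0 b_gt0 ab; have [p p_odd aE] := logn2_decomp a_gt0.
have [q q_odd bE] := logn2_decomp b_gt0.
have pq : (0 < p + q)%N by have := odd_gt0 p_odd; lia.
rewrite {2}aE bE -ab -mulnDl lognM ?expn_gt0 // pfactorK // -addn1 addnC leq_add2r.
by apply: logn2_even; rewrite // oddD p_odd q_odd.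
Qed.

Lemma gcd_cofactors_odd s t :
  (0 < s)%N -> odd (s %/ gcdn s t) || odd (t %/ gcdn s t).
Proof.
move=> s_gt0; apply/negPn/negP; rewrite negb_or => /andP[s_even t_even].
have g_gt0 : (0 < gcdn s t)%N by rewrite gcdn_gt0 s_gt0.
have : (2 * gcdn s t %| gcdn s t)%N.
  by rewrite dvdn_gcd -!dvdn_divRL ?dvdn_gcdl ?dvdn_gcdr // !dvdn2 s_even.
by move/(dvdn_leq g_gt0); lia.
Qed.

(** The two cofactors of the gcd are not both even, so an even one belongs to the number with the
    larger multiplicity of 2. *)
Lemma even_cofactor s t : (0 < s)%N -> (0 < t)%N ->
  ~~ odd (t %/ gcdn s t) = (logn 2 s < logn 2 t)%N.
Proof.
move=> s_gt0 t_gt0; have := gcd_cofactors_odd t s_gt0.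
rewrite [in RHS](logn2_split s_gt0 (dvdn_gcdl s t)).
rewrite [in RHS](logn2_split t_gt0 (dvdn_gcdr s t)) ltn_add2l.
have [t_odd _ | t_even] := boolP (odd (t %/ _)); first by rewrite (logn2_odd t_odd).
rewrite orbF => s_odd; rewrite (logn2_odd s_odd) logn2_even //.
by rewrite divn_gt0 ?gcdn_gt0 ?s_gt0 // (dvdn_leq t_gt0 (dvdn_gcdr s t)).
Qed.

(** By [translate_parity] the cofactors of the gcd have equal parity, so a strict inequality one way
    would force the reverse one as well. *)
Lemma flips_logn2_eq s t : (0 < s)%N -> (0 < t)%N ->
    (forall x, F (x + s%:R) = ~~ F x) -> (forall x, F (x + t%:R) = ~~ F x) ->
  logn 2 s = logn 2 t.
Proof.
move=> s_gt0 t_gt0 Fs Ft; have := @translate_parity s t true true Fs Ft.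
rewrite !andbT => eq_odd; have := even_cofactor s_gt0 t_gt0.
have := even_cofactor t_gt0 s_gt0; rewrite gcdnC eq_odd => ->.
by lia.
Qed.

(** The least common multiple fixes [F] as an iterate of [t], so it must consist of an even number
    of steps [s]. *)
Lemma flip_fix_logn2_lt s t : (0 < s)%N -> (0 < t)%N ->
    (forall x, F (x + s%:R) = ~~ F x) -> (forall x, F (x + t%:R) = F x) ->
  (logn 2 s < logn 2 t)%N.
Proof.
move=> s_gt0 t_gt0 Fs Ft; have := @translate_parity s t true false Fs Ft.
by rewrite andbT andbF -even_cofactor // => ->.
Qed.

End Translations.

(** * Two-colouring a union of two matchings *)

(* s never preserves an orbit of p = s * t: if s x = p^i x then s (i even) or
   t (i odd) fixes p^(i/2) x (rounded up).  So s exchanges the p-orbits in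
   pairs, and each pair gets opposite colours. *)
Lemma fixfree_involutions_colouring (T : finType) (s t : {perm T}) :
    (s * s = 1)%g -> (t * t = 1)%g -> (forall x, s x != x) -> (forall x, t x != x) ->
  exists f : T -> bool, forall x, f (s x) = ~~ f x /\ f (t x) = ~~ f x.
Proof.
move=> ss tt s_nfix t_nfix; pose p := (s * t)%g.
have sK x : s (s x) = x by rewrite -permM ss perm1.
have tK x : t (t x) = x by rewrite -permM tt perm1.
have pE x : p x = t (s x) by rewrite permM.
have psp n x : (p ^+ n)%g (s ((p ^+ n)%g x)) = s x.
  elim: n x => [|n IHn] x; first by rewrite !perm1.
  have pSr y : (p ^+ n.+1)%g y = p ((p ^+ n)%g y) by rewrite expgSr permM.
  have pS y : (p ^+ n.+1)%g y = (p ^+ n)%g (p y) by rewrite expgS permM.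
  by rewrite pSr pS IHn !pE sK tK.
have orbit_s x : s x \notin porbit p x.
  apply/negP => /porbitP[i sx].
  have s_mid : s ((p ^+ i./2)%g x) = (p ^+ (odd i + i./2)%N)%g x.
    apply: (@perm_inj _ (p ^+ i./2)%g).
    by rewrite psp sx -[in LHS](odd_double_half i) -addnn addnA expgD permM.
  case: (odd i) s_mid => s_mid; last by case/eqP: (s_nfix ((p ^+ i./2)%g x)).
  case/eqP: (t_nfix ((p ^+ (true + i./2)%N)%g x)).
  by rewrite -{1}s_mid -pE -permM -expgSr.
pose rk x := enum_rank (porbit p x).
have rk_s x : rk (s x) != rk x.
  by apply: contra (orbit_s x) => /eqP/enum_rank_inj/eqP; rewrite eq_porbit_mem.
have rkp x : rk (p x) = rk x by rewrite /rk -(porbit_perm p 1 x).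
(* Comparing ranks reverses under [s], and also under [t], because [t x = p (s x)] lies in the
   [p]-orbit of [s x]. *)
exists (fun x => (rk x < rk (s x))%N) => x.
have flip y z : y != z :> 'I_#|{set T}| -> (y < z)%N = ~~ (z < y)%N.
  by move=> yz; rewrite -leqNgt [RHS]leq_eqVlt (negPf (yz : val y != val z)).
have <- : p (s x) = t x by rewrite pE sK.
rewrite rkp sK; split; first by rewrite flip ?rk_s.
by rewrite -(rkp (s (p (s x)))) (psp 1%N) sK flip ?rk_s.
Qed.

(* Fixed points are removed by doubling T, a fixed point x being replaced by a
   swap of (x, true) and (x, false). *)
Lemma involutions_colouring (T : finType) (s t : T -> T) :
    involutive s -> involutive t ->
  exists f : T -> bool, forall x,
    (s x != x -> f (s x) = ~~ f x) /\ (t x != x -> f (t x) = ~~ f x).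
Proof.
move=> sK tK.
pose lift (u : T -> T) (xe : T * bool) :=
  if u xe.1 == xe.1 then (xe.1, ~~ xe.2) else (u xe.1, xe.2).
have liftK u : involutive u -> involutive (lift u).
  move=> uK [x e]; rewrite {2}/lift /=; case: eqP => [ux | /eqP ux].
    by rewrite /lift /= ux eqxx negbK.
  by rewrite /lift /= uK eq_sym (negPf ux).
have lift_nfix u xe : lift u xe != xe.
  case: xe => x e; rewrite /lift /=; case: ifP => [_|ux].
    by rewrite xpair_eqE eqxx; case: e.
  by rewrite xpair_eqE ux.
pose ps := perm (can_inj (liftK s sK)); pose pt := perm (can_inj (liftK t tK)).
have [||xe|xe|f fP] := @fixfree_involutions_colouring _ ps pt.
- by apply/permP => xe; rewrite permM !permE liftK.
- by apply/permP => xe; rewrite permM !permE liftK.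
- by rewrite permE.
- by rewrite permE.
(* Where [s] or [t] moves [x], its lift keeps the second coordinate, so the slice at [true] inherits
   the condition. *)
exists (fun x => f (x, true)) => x; have [] := fP (x, true).
by rewrite !permE /lift /=; do 2!case: eqP.
Qed.


(** * Arithmetic of Z/4m and colourings by exponents *)

Section Colourings.
Import GRing.Theory.
Local Open Scope ring_scope.

Variable m : nat.
Hypothesis m_gt0 : (0 < m)%N.
Local Notation Z := 'Z_(4 * m).
Local Notation M := ((2 * m)%:R : Z).

Let N_gt1 : (1 < 4 * m)%N. Proof. lia. Qed.

Lemma natZ_eq (x y : nat) : (x%:R == y%:R :> Z) = (x == y %[mod 4 * m])%N.
Proof. by rewrite -val_eqE /= !val_Zp_nat. Qed.

Lemma natZ_period : (4 * m)%:R = 0 :> Z.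
Proof. exact: pchar_Zp. Qed.

Lemma addMM : M + M = 0.
Proof. by rewrite -natrD -natZ_period; congr (_%:R); lia. Qed.

Lemma oppM : - M = M.
Proof. by apply/eqP; rewrite eq_sym -addr_eq0 addMM. Qed.

Lemma valZ_lt (x : Z) : (x < 4 * m)%N.
Proof. by rewrite -[X in (_ < X)%N](Zp_cast N_gt1). Qed.

(** Since 4m is even, the parity of the representative is a homomorphism from Z/4m to Z/2. *)
Definition oddZ (x : Z) := odd x.

Lemma oddZ_nat n : oddZ n%:R = odd n.
Proof. by rewrite /oddZ val_Zp_nat // odd_mod // oddM. Qed.

Lemma oddZD (x y : Z) : oddZ (x + y) = oddZ x (+) oddZ y.
Proof. by rewrite -{1}(natr_Zp x) -{1}(natr_Zp y) -natrD oddZ_nat oddD. Qed.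

Lemma oddZN (x : Z) : oddZ (- x) = oddZ x.
Proof.
have := oddZD x (- x); rewrite subrr (oddZ_nat 0) /=.
by do 2!case: (oddZ _).
Qed.

Lemma oddZM : oddZ M = false.
Proof. by rewrite oddZ_nat oddM. Qed.

Lemma evenZ_half (x : Z) : ~~ oddZ x -> exists y : Z, x = y + y.
Proof.
move=> x_even; exists (x./2)%:R; rewrite -natrD addnn -{1}(natr_Zp x).
by rewrite -[in LHS](odd_double_half x) (negPf (x_even : ~~ odd x)).
Qed.

Lemma neq_parity (x y : Z) : oddZ x != oddZ y -> x != y.
Proof. by apply: contra => /eqP->. Qed.

Lemma M_neq0 : M != 0.
Proof. by rewrite -[0]/(0%:R) natZ_eq mod0n modn_small; lia. Qed.

Lemma double_eq0 (x : Z) : x + x = 0 -> x = 0 \/ x = M.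
Proof.
move: (natr_Zp x) (valZ_lt x); move: (nat_of_ord x) => n <- n_lt /eqP.
rewrite -natrD -[0]/(0%:R) natZ_eq mod0n => /dvdnP[q nq].
have : (q * (4 * m) < 2 * (4 * m))%N by lia.
rewrite ltn_pmul2r; last by lia.
case: q nq => [|[|//]] nq _; [left | right].
  by rewrite (_ : n = 0%N) //; lia.
by congr (_%:R); lia.
Qed.

(** Multiplication by [z] iterates the translation by [y]. Reading a product in both orders then
    compares two translations. *)
Lemma translate_mulZ (F : Z -> bool) (s : bool) (y z : Z) :
  (forall x, F (x + y) = s (+) F x) -> F (y * z) = (oddZ z && s) (+) F 0.
Proof.
by move=> Fy; rewrite -[in LHS](natr_Zp z) mulr_natr -[_ *+ _]add0r (translate_mul Fy).
Qed.

(** [f] colours [a^x] and [g] colours [b a^x]. The clauses come from the factorizations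
    [a^(k-x) a^x] and [b a^x b a^(x+k+M)] of [a^k], and [a^x b a^(c+x)] and [b a^(c-x) a^x] of
    [b a^c]; the provisos on [k] say that the factors differ. *)
Definition proper_colouring (K C : {set 'Z_(4 * m)}) (f g : Z -> bool) : Prop :=
  [/\ forall k x, k \in K -> x + x != k -> f (k - x) = ~~ f x,
      forall k x, k \in K -> k != M -> g (x + (k + M)) = ~~ g x,
      forall c x, c \in C -> g (c + x) = ~~ f x
    & forall c x, c \in C -> g (c - x) = ~~ f x].

(** * Necessary conditions for a proper colouring *)

Section Obstructions.
Variables (K C : {set 'Z_(4 * m)}) (f g : Z -> bool).
Hypothesis fgP : proper_colouring K C f g.

Lemma colouring_fK (k x : Z) : k \in K -> x + x != k -> f (k - x) = ~~ f x.
Proof. by case: fgP => + _ _ _; apply. Qed.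
Lemma colouring_gK (k x : Z) : k \in K -> k != M -> g (x + (k + M)) = ~~ g x.
Proof. by case: fgP => _ + _ _; apply. Qed.
Lemma colouring_gC (c x : Z) : c \in C -> g (c + x) = ~~ f x.
Proof. by case: fgP => _ _ + _; apply. Qed.
Lemma colouring_gCN (c x : Z) : c \in C -> g (c - x) = ~~ f x.
Proof. by case: fgP => _ _ _; apply. Qed.

Lemma colouring_even (c x : Z) : c \in C -> f (- x) = f x.
Proof.
move=> cC; apply: negb_inj.
by rewrite -!(colouring_gC _ cC) (colouring_gCN _ cC) colouring_gC.
Qed.

(** The shift by [c] identifies [g] with the negation of [f], so the sign rule of [g] passes to
    [f]. *)
Lemma colouring_antiperiod (k c x : Z) : k \in K -> k != M -> c \in C ->
  f (x + (k + M)) = ~~ f x.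
Proof.
by move=> kK kM cC; apply: negb_inj; rewrite -!(colouring_gC _ cC) addrA colouring_gK.
Qed.

Lemma colouring_period (c d x : Z) : c \in C -> d \in C -> f (x + (d - c)) = f x.
Proof.
move=> cC dC; apply: negb_inj; rewrite -(colouring_gC _ cC) -(colouring_gC _ dC).
by congr g; ring.
Qed.

(* Otherwise x, n - x, l - n + x is a triangle. *)
Lemma no_even_triple (k l n : Z) : k \in K -> l \in K -> n \in K ->
  k != l -> l != n -> k != n -> oddZ (k + l + n).
Proof.
move=> kK lK nK kl ln kn; apply/negPn/negP => even_sum.
(* With [2x = k - l + n] the elements [x] and [l - n + x] sum to [k], which closes the triangle. *)
have [|x klnx] := @evenZ_half (k - l + n).
  by move: even_sum; rewrite !oddZD oddZN.
have := colouring_fK (x := x) nK; have := colouring_fK (x := n - x) lK.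
have := colouring_fK (x := l - (n - x)) kK.
have -> : k - (l - (n - x)) = x.
  by apply: (@addIr _ x); rewrite -klnx; ring.
have -> : l - (n - x) + (l - (n - x)) = k + l - n.
  transitivity (l + l - n - n + (x + x)); first by ring.
  by rewrite -klnx; ring.
have -> : n - x + (n - x) = n + l - k.
  transitivity (n + n - (x + x)); first by ring.
  by rewrite -klnx; ring.
rewrite -klnx; move=> f3 f2 f1.
have ne1 : k - l + n != n by rewrite -subr_eq0 addrK subr_eq0.
have ne2 : n + l - k != l.
  by rewrite -subr_eq0 (_ : _ - l = n - k) ?subr_eq0 1?eq_sym //; ring.
have ne3 : k + l - n != k.
  by rewrite -subr_eq0 (_ : _ - k = l - n) ?subr_eq0 //; ring.
by move: (f3 ne3); rewrite (f2 ne2) (f1 ne1); case: (f x).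
Qed.

(** Otherwise translating [g] by [(k + M) * (l + M)] is an odd number of flips by [k + M] and an
    even number of flips by [l + M]. *)
Lemma no_mixed_parity (k l : Z) : k \in K -> l \in K -> k != M -> oddZ l -> oddZ k.
Proof.
move=> kK lK kM l_odd; apply/negPn/negP => k_even.
have lM : l != M by apply: neq_parity; rewrite l_odd oddZM.
have := @translate_mulZ g true (k + M) (l + M) (fun x => colouring_gK x kK kM).
rewrite mulrC (@translate_mulZ g true (l + M) (k + M) (fun x => colouring_gK x lK lM)).
by rewrite !oddZD oddZM l_odd (negPf k_even); case: (g 0).
Qed.

(** Write [k = 2y]. As [f] is even and flipped by [k + M], moving [- y] to [y + M] gives
    [f (y + M) = ~~ f y]. The sum rule at [- y] gives [f (k + y) = ~~ f y], hence
    [f (- y + M) = f y]; evenness makes these two values equal. For [k = 0] the sum rule at 1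
    already contradicts evenness. *)
Lemma even_rotation_reflection (k c : Z) : k \in K -> c \in C -> ~~ oddZ k -> k = M.
Proof.
move=> kK cC k_even; apply/eqP/negPn/negP => kM.
have shift (x : Z) := colouring_antiperiod x kK kM cC.
have even (x : Z) := colouring_even x cC.
have [y ky] := evenZ_half k_even.
have [k0 | k_neq0] := eqVneq k 0.
  have := colouring_fK (x := 1) kK; rewrite k0 sub0r even => /(_ _)/esym.
  have two_neq0 : (1 + 1 : Z) != 0.
    by rewrite -(natrD _ 1 1) -[0]/(0%:R) natZ_eq mod0n modn_small; lia.
  by move/(_ two_neq0); case: (f 1).
have yM : f (y + M) = ~~ f y.
  rewrite -[f y in RHS]even -shift; congr f.
  by rewrite ky; ring.
have ny : - y + - y != k.
  apply/negP => /eqP nyk; have : k + k = 0 by rewrite -{2}nyk {1}ky; ring.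
  by case/double_eq0 => [k0|kM']; [case/eqP: k_neq0|case/eqP: kM].
have fyk := colouring_fK kK ny; rewrite !even in fyk.
have fyM : f (- y + M) = f y.
  by rewrite -[RHS]negbK -fyk -(even (k - - y)) -shift; congr f; ring.
move: fyM; rewrite -even (_ : - (- y + M) = y + - M); last by ring.
by rewrite oppM yM; case: (f y).
Qed.

(* f is even, and f (x + M) = ~~ f x unless x + x = M; hence f (m + M) = f m,
   and translating by the period d - c breaks the second rule at m + d - c. *)
Lemma no_two_reflections (c d : Z) : M \in K -> c \in C -> d \in C -> c = d.
Proof.
move=> MK cC dC; apply/eqP/negPn/negP => cd.
have even (x : Z) := colouring_even x cC.
have period (x : Z) := colouring_period x cC dC.
have antiperiod (x : Z) : x + x != M -> f (x + M) = ~~ f x.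
  by move=> xM; rewrite -even -(colouring_fK MK xM) opprD oppM addrC.
have m2 : m%:R + m%:R = M by rewrite -natrD addnn mul2n.
have mM : f (m%:R + M) = f m%:R.
  by rewrite -even opprD oppM -m2 addrA addNr add0r.
have /antiperiod : (m%:R + (d - c)) + (m%:R + (d - c)) != M.
  rewrite addrACA m2 -subr_eq0 addrAC subrr add0r.
  apply/negP => /eqP/double_eq0[/eqP|dcM].
    by rewrite subr_eq0 eq_sym (negPf cd).
  (* When [d - c = M], the period contradicts the sign change at 0. *)
  have /antiperiod : 0 + 0 != M by rewrite addr0 eq_sym M_neq0.
  by rewrite -dcM period; case: (f 0).
by rewrite addrAC !period mM; case: (f _).
Qed.

(** [f M] is opposite to [f 0] by the sum rule for [M], and opposite to [f (- k)] by the flip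
    [k + M]. So [f k = f (- k) = f 0], although 0 and [k] sum to [k]. *)
Lemma no_odd_rotation_reflection (k c : Z) :
  M \in K -> k \in K -> c \in C -> ~~ oddZ k.
Proof.
move=> MK kK cC; apply/negP => k_odd.
have kM : k != M by apply: neq_parity; rewrite k_odd oddZM.
have kx (x : Z) : x + x != k.
  by apply: neq_parity; rewrite oddZD addbb k_odd.
have even (x : Z) := colouring_even x cC.
have shift (x : Z) := colouring_antiperiod x kK kM cC.
have f0M : f (0 + M) = ~~ f 0.
  by rewrite -(colouring_fK MK) ?subr0 ?add0r // eq_sym M_neq0.
have := shift (- k); rewrite (_ : - k + _ = 0 + M) ?f0M; last by ring.
by rewrite even -{1}(subr0 k) colouring_fK //; case: (f 0).
Qed.

(** An odd period [d - c] would contradict the flip [k + M] at their product. *)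
Lemma reflections_parity (k c d : Z) :
  k \in K -> oddZ k -> c \in C -> d \in C -> oddZ c = oddZ d.
Proof.
move=> kK k_odd cC dC; apply/eqP/negPn/negP => cd.
have kM : k != M by apply: neq_parity; rewrite k_odd oddZM.
have dc_odd : oddZ (d - c) by rewrite oddZD oddZN; move: cd; do 2!case: (oddZ _).
have := @translate_mulZ f true (k + M) (d - c)
  (fun x => colouring_antiperiod x kK kM cC).
rewrite mulrC (@translate_mulZ f false _ (k + M) (fun x => colouring_period x cC dC)).
by rewrite dc_odd andbF; case: (f 0).
Qed.

Lemma rotation_flip (k : nat) :
  k%:R \in K -> k%:R != M -> forall x : Z, g (x + (k + 2 * m)%:R) = ~~ g x.
Proof. by move=> kK kM x; rewrite natrD colouring_gK. Qed.

(** On Z/4m the number 4m is a period of [g], and its multiplicity of 2 exceeds that of 2m by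
    one. *)
Lemma rotation_weight_le (k : nat) : k%:R \in K -> k%:R != M ->
  (logn 2 (k + 2 * m) <= logn 2 (2 * m))%N.
Proof.
move=> kK kM; rewrite -ltnS -[X in (_ < X)%N]logn2_double; last lia.
rewrite (_ : 2 * (2 * m) = 4 * m)%N; last lia.
apply: (@flip_fix_logn2_lt Z g); [lia | lia | exact: rotation_flip |].
by move=> x; rewrite natZ_period addr0.
Qed.

Lemma rotations_weight (k l : nat) : k%:R \in K -> k%:R != M ->
  l%:R \in K -> l%:R != M -> logn 2 (k + 2 * m) = logn 2 (l + 2 * m).
Proof.
move=> kK kM lK lM.
by apply: (@flips_logn2_eq Z g); [lia | lia | exact: rotation_flip..].
Qed.

End Obstructions.

(** * Construction of proper colourings *)

(** Adding an odd multiple of [2 ^ v] flips the binary digit of index [v]; reduction modulo 4m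
    preserves this digit because [2 ^ v.+1] divides 4m. *)
Lemma binary_digit_flip (s : nat) (x : Z) : (0 < s)%N ->
    (logn 2 s <= logn 2 (2 * m))%N ->
  odd (((x + s%:R)%R : Z) %/ 2 ^ logn 2 s)%N = ~~ odd (x %/ 2 ^ logn 2 s)%N.
Proof.
move=> s_gt0; have [q q_odd] := logn2_decomp s_gt0.
move: (logn 2 s) => v sE v_le.
have /dvdnP[r mE] : (2 ^ v.+1 %| 4 * m)%N.
  rewrite expnS (_ : 4 * m = 2 * (2 * m))%N ?dvdn_pmul2l //; last by lia.
  by rewrite pfactor_dvdn //; lia.
rewrite -{1}(natr_Zp x) -natrD val_Zp_nat //; move: (nat_of_ord x) => y.
rewrite mE expnS mulnA -modn_divl odd_mod.
  by rewrite sE addnC divnMDl ?expn_gt0 // oddD q_odd.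
by rewrite oddM andbF.
Qed.

Lemma proper_rotations (k l : Z) (g : Z -> bool) :
    (forall j x : Z, j \in [set k; l] -> j != M -> g (x + (j + M)) = ~~ g x) ->
  exists f, proper_colouring [set k; l] set0 f g.
Proof.
move=> gP; have subK (j : Z) : involutive (fun x => j - x) by move=> x; ring.
have [f fP] := involutions_colouring (subK k) (subK l).
exists f; split=> [j x|j x|c x|c x].
- move=> jK jx; have jxx : j - x != x.
    by apply: contra jx => /eqP jE; rewrite -{1}jE subrK.
  by move: jK; rewrite !inE => /orP[] /eqP jE; have [] := fP x; rewrite -jE => *; auto.
- exact: gP.
- by rewrite inE.
- by rewrite inE.
Qed.

(** The colours are the cosets of the subgroup of index 2 generated by [a^2] and [b] when [p] is
    true, by [a^2] and [b a] otherwise. *)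
Lemma proper_parity (p : bool) :
  proper_colouring [set k | oddZ k] [set c | oddZ c == p]
    oddZ (fun x => oddZ x (+) ~~ p).
Proof.
split=> [k x|k x|c x|c x]; rewrite inE !oddZD ?oddZN ?oddZM.
- by move->.
- by move=> ->; case: (oddZ x) p => [] [].
- by move/eqP->; case: (oddZ x) p => [] [].
- by move/eqP->; case: (oddZ x) p => [] [].
Qed.

(** [f] is the indicator of the closed arc from [-m] to [m]. It is symmetric about 0, and
    [x -> M - x] exchanges the arc with its complement except at the ends, which this map fixes. *)
Lemma proper_M_reflection (c : Z) : exists f g, proper_colouring [set M] [set c] f g.
Proof.
pose h (u : Z) := (u <= 2 * m)%N; pose f (x : Z) := h (x + m%:R).
have m2 : m%:R + m%:R = M by rewrite -natrD addnn mul2n.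
have hE n : (n < 4 * m)%N -> h n%:R = (n <= 2 * m)%N.
  by move=> n_lt; rewrite /h val_Zp_nat // modn_small.
have natB (a b d : nat) : (d + b = a %[mod 4 * m])%N -> a%:R - b%:R = d%:R :> Z.
  by move/eqP; rewrite -natZ_eq natrD => /eqP<-; rewrite addrK.
have hN (u : Z) : u + u != 0 -> h (- u) = ~~ h u.
  move: (natr_Zp u) (valZ_lt u); move: (nat_of_ord u) => n <- n_lt.
  rewrite -natrD -[0]/(0%:R) natZ_eq => nn.
  have n_neq0 : n <> 0%N by move=> n0; rewrite n0 eqxx in nn.
  have n_neq2m : n <> (2 * m)%N.
    by move=> n0; rewrite n0 (_ : _ + _ = 4 * m)%N ?modnn ?mod0n // in nn; lia.
  rewrite -sub0r (natB 0%N n (4 * m - n)%N) ?subnK ?modnn ?mod0n //; last exact: ltnW.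
  by rewrite !hE //; lia.
have hM (u : Z) : h (M - u) = h u.
  move: (natr_Zp u) (valZ_lt u); move: (nat_of_ord u) => n <- n_lt.
  have [n_le | n_gt] := leqP n (2 * m).
    by rewrite (natB _ _ (2 * m - n)%N) ?subnK // !hE //; lia.
  rewrite (natB _ _ (2 * m + 4 * m - n)%N); last by rewrite subnK ?modnDr //; lia.
  by rewrite !hE //; lia.
have f_even (x : Z) : f (- x) = f x.
  by rewrite /f -hM -m2; congr h; ring.
exists f, (fun y => ~~ f (y - c)); split=> [k x|k x|d x|d x]; rewrite inE => /eqP->.
- move=> xM; rewrite /f -hN; last by rewrite addrACA m2 addr_eq0 oppM.
  by congr h; rewrite -[RHS]addr0 -addMM -m2; ring.
- by rewrite eqxx.
- by congr (~~ f _); ring.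
- by rewrite -f_even; congr (~~ f _); ring.
Qed.

End Colourings.

(** * Avoidability as two-colourability *)

Section AvoidableColouring.
Local Open Scope group_scope.
Variables (gT : finGroupType) (U : {set gT}).

(* If the colouring is constant then no product of distinct elements lies in
   U, and any other colouring works; this makes both blocks nonempty. *)
Lemma avoidable_colouring : (1 < #|gT|)%N ->
  avoidable U <->
  exists F : gT -> bool, forall x y, x != y -> x * y \in U -> F x = ~~ F y.
Proof.
move=> gT_gt1.
split=> [/existsP[A /existsP[B /and3P[AB part /'forall_forallP UP]]] | [F FP]].
  have [/eqP covAB trivAB _] := and3P part.
  have AB_cover x : (x \in A) || (x \in B).
    have : x \in cover [set A; B] by rewrite covAB inE.
    by case/bigcupP=> X; rewrite !inE => /orP[] /eqP-> ->; rewrite ?orbT.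
  have AB_disj : [disjoint A & B].
    by apply: (trivIsetP trivAB); rewrite ?inE ?eqxx ?orbT.
  have inB x : (x \in B) = (x \notin A).
    have := AB_cover x; case: (boolP (x \in A)) => [xA _|//].
    exact: disjointFr AB_disj xA.
  exists (mem A) => x y xy xyU; move/(_ x y): UP; rewrite xy xyU !inB implybF.
  by rewrite !inE; case: (x \in A); case: (y \in A).
have [G [GP [u [v [Gu Gv]]]]] : exists G : gT -> bool,
    (forall x y, x != y -> x * y \in U -> G x = ~~ G y)
    /\ exists u v, G u /\ ~~ G v.
  have [/existsP[u Fu] | noF] := boolP [exists u, F u].
    have [/existsP[v Fv] | allF] := boolP [exists v, ~~ F v].
      by exists F; split=> //; exists u, v.
    exists (pred1 1); split=> [x y xy xyU|].
      have := FP x y xy xyU; move/existsPn: allF => allF.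
      by rewrite (negbNE (allF x)) (negbNE (allF y)).
    have /card_gt1P[x [y [_ _ xy]]] := gT_gt1; rewrite /=.
    have [x1|x1] := eqVneq x 1; [exists x, y | exists 1, x]; rewrite ?x1 ?eqxx //.
    by rewrite eq_sym -x1.
  exists (pred1 1); split=> [x y xy xyU|].
    have := FP x y xy xyU; move/existsPn: noF => noF.
    by rewrite (negPf (noF x)) (negPf (noF y)).
  have /card_gt1P[x [y [_ _ xy]]] := gT_gt1; rewrite /=.
  have [x1|x1] := eqVneq x 1; [exists x, y | exists 1, x]; rewrite ?x1 ?eqxx //.
  by rewrite eq_sym -x1.
pose A := [set x | G x].
have uA : u \in A by rewrite inE.
have vA : v \in ~: A by rewrite !inE.
have AnA : A != ~: A.
  by apply/eqP => AE; have := uA; rewrite {1}AE inE uA.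
apply/existsP; exists A; apply/existsP; exists (~: A); apply/and3P; split=> //.
  apply/and3P; split.
  - by rewrite /cover bigcup_setU !big_set1 setUCr.
  - apply/trivIsetP => X Y; rewrite !inE => /orP[] /eqP-> /orP[] /eqP->.
    + by rewrite eqxx.
    + by rewrite -setI_eq0 setICr.
    + by rewrite -setI_eq0 setIC setICr.
    + by rewrite eqxx.
  - by rewrite !inE negb_or; apply/andP; split; apply/eqP => /esym A0;
      [rewrite A0 inE in uA | rewrite A0 inE in vA].
apply/'forall_forallP => x y; apply/implyP => /andP[xy xyA].
apply/negP => /(GP x y xy) Gxy; move: xyA; rewrite !inE Gxy.
by case: (G y).
Qed.

End AvoidableColouring.

(** * A permutation model bounding the order of the group from below *)

Section QuaternionModel.
Import GRing.Theory.
Local Open Scope ring_scope.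
Variable m : nat.
Hypothesis m_gt0 : (0 < m)%N.
Local Notation Z := 'Z_(4 * m).
Local Notation M := ((2 * m)%:R : Z).

(* Right multiplication by the generators in the regular representation, with
   (x, false) for a^x and (x, true) for b a^x. *)
Definition model_a (p : Z * bool) : Z * bool := (p.1 + 1, p.2).
Definition model_b (p : Z * bool) : Z * bool :=
  if p.2 then (M - p.1, false) else (- p.1, true).

Lemma model_a_inj : injective model_a.
Proof.
move=> [x e] [y e'] /eqP; rewrite xpair_eqE /= => /andP[/eqP eq_x /eqP->].
suff -> : x = y by []; apply: addIr eq_x.
Qed.

Lemma model_b_inj : injective model_b.
Proof.
move=> [x []] [y []] /eqP; rewrite xpair_eqE ?andbF //= andbT => /eqP eq_x.
- suff -> : x = y by []; apply: oppr_inj; apply: addrI eq_x.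
- by rewrite (oppr_inj eq_x).
Qed.

Let alpha := perm model_a_inj.
Let beta := perm model_b_inj.

Lemma alphaX n x e : (alpha ^+ n)%g (x, e) = (x + n%:R, e).
Proof.
elim: n x => [|n IHn] x; first by rewrite perm1 addr0.
by rewrite expgS permM permE /model_a /= IHn -addrA -mulrS.
Qed.

(** [alpha] and [beta] satisfy the relations, so they generate a quotient of the presented group,
    and the orbit of [(0, false)] under it is all of the 8m points. *)
Lemma model_card (gT : finGroupType) :
    ([set: gT] \isog
       Grp (x : y : x ^+ (4 * m) = 1, y ^+ 2 = x ^+ (2 * m), y * x = x^-1 * y))%g ->
  (8 * m <= #|gT|)%N.
Proof.
move=> isoQ; pose H := (<[alpha]> <*> <[beta]>)%G.
have homH : (H \homg [set: gT])%g.
  rewrite isoQ; apply/existsP; exists (alpha, beta) => /=.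
  rewrite !xpair_eqE eqxx /=; apply/and3P; split; apply/eqP.
  - by apply/permP => -[x e]; rewrite alphaX perm1 natZ_period // addr0.
  - apply/permP => -[x []]; rewrite alphaX expgS expg1 permM !permE /model_b /=.
      by rewrite opprB oppM.
    by rewrite opprK addrC.
  - apply: (mulgI alpha); rewrite mulKVg; apply/permP => -[x []].
      by rewrite !permM !permE /model_a /model_b /=; congr (_, _); ring.
    by rewrite !permM !permE /model_a /model_b /=; congr (_, _); ring.
have H_le : (#|H| <= #|gT|)%N.
  by rewrite -cardsT dvdn_leq ?(card_homg homH) // (cardG_gt0 [set: gT]%G).
apply: leq_trans H_le.
have -> : (8 * m = #|{: Z * bool}|)%N.
  by rewrite card_prod card_bool card_ord Zp_cast //; lia.
apply: leq_trans (leq_imset_card (fun s : {perm Z * bool} => s (0, false)) H).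
apply/subset_leq_card/subsetP => -[x e] _; apply/imsetP.
exists (if e then beta * alpha ^+ x else alpha ^+ x)%g.
  by case: e; rewrite ?groupM ?groupX // mem_gen // inE cycle_id ?orbT.
case: e; rewrite ?permM ?permE /model_b /= ?oppr0 ?alphaX ?add0r ?natr_Zp //.
Qed.

End QuaternionModel.

(** * Coordinates and the multiplication table *)

Section QuaternionCoordinates.
Import GRing.Theory.
Variables (m : nat) (gT : finGroupType) (a b : gT).
Hypothesis m_gt0 : (0 < m)%N.
Hypothesis Qm : generalized_quaternion m a b.
Local Notation Z := 'Z_(4 * m).
Local Notation M := ((2 * m)%:R%R : Z).

Definition rho (x : Z) : gT := (a ^+ x)%g.
Definition sigma (x : Z) : gT := (b * a ^+ x)%g.

Let N_gt1 : (1 < 4 * m)%N. Proof. lia. Qed.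

Lemma rho_nat n : (a ^+ n)%g = rho n%:R%R.
Proof.
case: Qm => _ [aN _ _] _; rewrite /rho val_Zp_nat //.
by rewrite [in LHS](divn_eq n (4 * m)) expgD mulnC expgM aN expg1n mul1g.
Qed.

Lemma sigma_nat n : (b * a ^+ n)%g = sigma n%:R%R.
Proof. by rewrite rho_nat. Qed.

Lemma rho0 : rho 0%R = 1%g.
Proof. by rewrite /rho expg0. Qed.

Lemma rhoM x y : (rho x * rho y)%g = rho (x + y)%R.
Proof.
rewrite -[in RHS](natr_Zp x) -[in RHS](natr_Zp y) -natrD -rho_nat.
by rewrite expgD.
Qed.

Lemma rhoV x : (rho x)^-1%g = rho (- x)%R.
Proof. by apply/eqP; rewrite eq_invg_mul rhoM subrr rho0. Qed.

Lemma rho_b x : (rho x * b = b * rho (- x)%R)%g.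
Proof.
case: Qm => _ [_ _ ba] _; rewrite -rhoV; apply: (mulIg (rho x)); rewrite mulgKV.
have ab : (a * b * a = b)%g by rewrite -mulgA ba mulKVg.
rewrite /rho; elim: (nat_of_ord x) => [|n IHn]; first by rewrite mulg1 mul1g.
by rewrite {1}expgSr expgS mulgA -(mulgA _ a b) -(mulgA _ (a * b)%g) ab.
Qed.

Lemma rho_sigma x y : (rho x * sigma y = sigma (y - x)%R)%g.
Proof. by rewrite /sigma mulgA rho_b -mulgA -/(rho y) rhoM addrC. Qed.

Lemma sigma_rho x y : (sigma x * rho y = sigma (x + y)%R)%g.
Proof. by rewrite /sigma -mulgA rhoM. Qed.

Lemma sigma_sigma x y : (sigma x * sigma y = rho (y - x + M)%R)%g.
Proof.
case: Qm => _ [_ bb _] _.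
by rewrite -mulgA rho_sigma mulgA -expg2 bb rho_nat rhoM addrC.
Qed.

Definition coord (p : Z * bool) : gT := if p.2 then sigma p.1 else rho p.1.

(** By the multiplication table the image of [coord] is closed under products, hence a subgroup, and
    it contains both generators. *)
Lemma coord_surj : [set coord p | p : Z * bool] = [set: gT].
Proof.
have gS : group_set [set coord p | p : Z * bool].
  apply/group_setP; split; first by apply/imsetP; exists (0%R, false); rewrite ?rho0.
  move=> _ _ /imsetP[[x e] _ ->] /imsetP[[y d] _ ->]; apply/imsetP.
  rewrite /coord /=; case: e d => [] [] /=.
  - by exists ((y - x + M)%R, false); rewrite ?sigma_sigma.
  - by exists ((x + y)%R, true); rewrite ?sigma_rho.
  - by exists ((y - x)%R, true); rewrite ?rho_sigma.
  - by exists ((x + y)%R, false); rewrite ?rhoM.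
case: (Qm) => <- _ _; apply/eqP; rewrite eqEsubset; apply/andP; split.
  by case: (Qm) => -> _ _; apply: subsetT.
rewrite -[[set _ | _ in _]]/(gval (Group gS)) gen_subG.
apply/subsetP => g; rewrite !inE => /orP[] /eqP->; apply/imsetP.
  by exists (1%R, false) => //; rewrite /coord /= -(rho_nat 1) expg1.
by exists (0%R, true) => //; rewrite /coord /sigma /= expg0 mulg1.
Qed.

Lemma card_coord : #|{: Z * bool}| = (8 * m)%N.
Proof. by rewrite card_prod card_bool card_ord Zp_cast //; lia. Qed.

Lemma card_quaternion : #|gT| = (8 * m)%N.
Proof.
apply/eqP; rewrite eqn_leq; apply/andP; split.
  rewrite -cardsT -coord_surj -card_coord; exact: leq_imset_card.
by case: Qm => _ _; apply: model_card.
Qed.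

Lemma coord_bij : bijective coord.
Proof.
apply: inj_card_bij; last by rewrite card_quaternion card_coord.
have /imset_injP inj : #|coord @: [set: Z * bool]| == #|[set: Z * bool]|.
  rewrite cardsT card_coord -card_quaternion -cardsT -coord_surj.
  apply/eqP; congr #|pred_of_set _|; apply/setP => g.
  by apply/imsetP/imsetP => -[p _ ->]; exists p.
by move=> p q; apply: inj; rewrite inE.
Qed.

Lemma rho_inj : injective rho.
Proof. by move=> x y /(bij_inj coord_bij (x1 := (x, false)) (x2 := (y, false)))[]. Qed.

Lemma sigma_inj : injective sigma.
Proof. by move=> x y /(bij_inj coord_bij (x1 := (x, true)) (x2 := (y, true)))[]. Qed.

Lemma rho_neq_sigma x y : rho x != sigma y.
Proof.
by apply/eqP => /(bij_inj coord_bij (x1 := (x, false)) (x2 := (y, true))).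
Qed.

Lemma coordP (g : gT) : (exists x, g = rho x) \/ (exists x, g = sigma x).
Proof.
have : g \in [set coord p | p : Z * bool] by rewrite coord_surj inE.
by case/imsetP => -[x []] _ ->; [right | left]; exists x.
Qed.

Lemma avoidableP (U : {set gT}) :
  avoidable U <-> exists f g, proper_colouring (rho @^-1: U) (sigma @^-1: U) f g.
Proof.
have card_gt1 : (1 < #|gT|)%N by rewrite card_quaternion; lia.
rewrite avoidable_colouring //; split=> [[F FP] | [f [g [fP gP cP c'P]]]].
  have FPr x y : x != y -> (x * y)%g \in U -> F y = ~~ F x.
    by move=> xy xyU; rewrite (FP x y xy xyU) negbK.
  exists (F \o rho), (F \o sigma); split=> [k x|k x|c x|c x]; rewrite inE /= => kU.
  - move=> xk; apply: FP; last by rewrite rhoM subrK.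
    rewrite (inj_eq rho_inj); apply: contra xk => /eqP kx.
    by rewrite -{1}kx subrK.
  - move=> kM; apply: FPr.
      rewrite (inj_eq sigma_inj) -subr_eq0 opprD addNKr oppr_eq0 addr_eq0 oppM //.
    rewrite sigma_sigma (_ : x + (k + M) - x + M = k + (M + M))%R; last by ring.
    by rewrite addMM // addr0.
  - apply: FPr; first exact: rho_neq_sigma.
    by rewrite rho_sigma addrK.
  - apply: FP; first by rewrite eq_sym rho_neq_sigma.
    by rewrite sigma_rho subrK.
have [coord' coordK coord'K] := coord_bij.
pose F h := let: (x, e) := coord' h in if e then g x else f x.
have Frot x : F (rho x) = f x by rewrite /F -[rho x]/(coord (x, false)) coordK.
have Frefl x : F (sigma x) = g x by rewrite /F -[sigma x]/(coord (x, true)) coordK.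
exists F => u v; case: (coordP u) => -[x ->]; case: (coordP v) => -[y ->].
- rewrite (inj_eq rho_inj) rhoM !Frot => xy xyU.
  rewrite -[x](addrK y); apply: fP; rewrite ?inE //.
  by rewrite (inj_eq (addIr _)) eq_sym.
- rewrite rho_sigma Frot Frefl => _ yxU.
  by rewrite -[y in RHS](subrK x) cP ?inE // negbK.
- rewrite sigma_rho Frot Frefl => _ xyU.
  by rewrite -{1}[x](addrK y) c'P // inE.
rewrite (inj_eq sigma_inj) sigma_sigma !Frefl => xy xyU.
rewrite -[g x]negbK -(gP (y - x + M)%R x) ?inE //.
  by rewrite -(addrA _ M) addMM // addr0 addrC subrK.
by rewrite -subr_eq0 addrK subr_eq0 eq_sym.
Qed.


(** A colouring proper for larger sets of exponents suffices, so the preimages of [U] need not be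
    computed exactly. *)
Lemma avoidable_sub (K C : {set Z}) f g (U : {set gT}) :
    proper_colouring K C f g -> (forall x, rho x \in U -> x \in K) ->
  (forall x, sigma x \in U -> x \in C) -> avoidable U.
Proof.
move=> [fP gP cP c'P] UK UC; apply/avoidableP; exists f, g.
split=> [k x|k x|c x|c x]; rewrite inE.
- by move/UK; apply: fP.
- by move/UK; apply: gP.
- by move/UC; apply: cP.
- by move/UC; apply: c'P.
Qed.

(** * Avoidable sets containing an even rotation *)

(** Of two further rotations exactly one would be odd, by the triple and parity obstructions; the
    remaining two even exponents would then both be [M]. A reflection forces [k = M]; this makes any
    further rotation equal to [rho M] and excludes a second reflection. *)
Lemma even_rotation_card (U : {set gT}) (k : Z) :
  avoidable U -> rho k \in U -> ~~ oddZ k -> #|U| <= 2.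
Proof.
move=> /avoidableP[f [g fgP]] kU k_even; rewrite leqNgt; apply/negP => U_gt2.
have : 1 < #|U :\ rho k| by move: U_gt2; rewrite (cardsD1 (rho k)) kU.
case/card_gt1P=> u [v []]; rewrite !in_setD1 => /andP[uk uU] /andP[vk vU] uv.
have mixed l n : rho l \in U -> rho n \in U -> l != M -> oddZ n -> oddZ l.
  by move=> lU nU lM n_odd; apply: (no_mixed_parity m_gt0 fgP (l := n)); rewrite ?inE.
have no_sigma l c : rho l \in U -> sigma c \in U -> l != k -> False.
  move=> lU cU lk; have kM : k = M.
    by apply: (even_rotation_reflection m_gt0 fgP (c := c)); rewrite ?inE.
  have l_even : ~~ oddZ l.
    by apply: (no_odd_rotation_reflection m_gt0 fgP (c := c)); rewrite ?inE -?kM.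
  case/eqP: lk; rewrite kM.
  by apply: (even_rotation_reflection m_gt0 fgP (c := c)); rewrite ?inE.
have no_odd l n : rho l \in U -> rho n \in U -> l != k -> ~~ oddZ l -> oddZ n -> False.
  move=> lU nU lk l_even n_odd; have [kM|kM] := eqVneq k M.
    by move: l_even; rewrite (mixed l n) // -kM.
  by move: k_even; rewrite (mixed k n).
move: uU vU uk vk uv.
case: (coordP u) => -[l ->]; case: (coordP v) => -[n ->].
- rewrite !(inj_eq rho_inj) => lU nU lk nk ln.
  have : oddZ (k + l + n)%R.
    by apply: (no_even_triple m_gt0 fgP); rewrite ?inE // eq_sym.
  rewrite !oddZD // (negPf k_even) /=.
  case l_odd: (oddZ l); case n_odd: (oddZ n) => // _.
    by apply: (no_odd n l); rewrite ?n_odd.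
  by apply: (no_odd l n); rewrite ?l_odd.
- rewrite (inj_eq rho_inj) => lU cU lk _ _; exact: no_sigma lU cU lk.
- rewrite (inj_eq rho_inj) => cU lU _ lk _; exact: no_sigma lU cU lk.
rewrite (inj_eq sigma_inj) => cU dU _ _ /eqP; apply.
have kM : k = M by apply: (even_rotation_reflection m_gt0 fgP (c := l)); rewrite ?inE.
by apply: (no_two_reflections m_gt0 fgP); rewrite ?inE -?kM.
Qed.

Lemma pair_saturated (k : Z) (u : gT) : ~~ oddZ k -> u != rho k ->
  avoidable [set rho k; u] -> saturated [set rho k; u].
Proof.
move=> k_even uk av; apply/maxsetP; split=> // V avV sUV; apply/esym/eqP.
have kV : rho k \in V by rewrite (subsetP sUV) // set21.
by rewrite eqEcard sUV cards2 eq_sym uk (even_rotation_card avV kV).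
Qed.

Lemma pair_eq (U : {set gT}) (k : Z) (u : gT) : avoidable U -> rho k \in U ->
  ~~ oddZ k -> u \in U -> u != rho k -> U = [set rho k; u].
Proof.
move=> avU kU k_even uU uk; apply/esym/eqP; rewrite eqEcard.
rewrite cards2 eq_sym uk (even_rotation_card avU kU) // andbT.
by apply/subsetP => x; rewrite !inE => /orP[] /eqP->.
Qed.

(** * Weights and pairs of rotations *)

Local Notation e := (logn 2 (2 * m)).
(** For [a^k] in an avoidable set with [k] different from [M], the translation by [k + 2m] flips the
    colours of reflections; its multiplicity of 2 decides which pairs are compatible. *)
Local Notation weight k := (logn 2 (k + 2 * m)).

(** The case [k = 0] belongs with the large multiplicities, although [logn 2 0] is 0 by
    convention. *)
Lemma weight_cases k :
  [\/ [/\ 0 < k, logn 2 k < e & weight k = logn 2 k],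
      (k = 0 \/ e < logn 2 k) /\ weight k = e
    | logn 2 k = e /\ e < weight k].
Proof.
have [-> | k_gt0] := posnP k; first by constructor 2; split; [left|].
have [lt_ke | gt_ke | eq_ke] := ltngtP (logn 2 k) e.
- by constructor 1; rewrite logn2_add_lt.
- by constructor 2; rewrite addnC logn2_add_lt; [split; [right|]|lia|].
- by constructor 3; rewrite -eq_ke; split=> //; apply: logn2_add_eq; lia.
Qed.

Lemma weight_le k : (weight k <= e) = (logn 2 k != e).
Proof.
have e_gt0 : 0 < e by rewrite logn2_double.
case: (weight_cases k) => [[_ lt_ke ->]|[[->|gt_ke] ->]|[-> gt_w]].
- by lia.
- by rewrite logn0; lia.
- by lia.
- by lia.
Qed.

Lemma logn2_modulus : logn 2 (4 * m) = e.+1.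
Proof.
have -> : 4 * m = 2 * (2 * m) by lia.
by rewrite (@logn2_double (2 * m)) //; lia.
Qed.

Lemma weight_M (k : nat) : weight k <= e -> k%:R%R != M.
Proof.
move=> wk; apply/negP => /eqP/(congr1 (fun x => x + M)%R).
rewrite addMM // -natrD => /eqP; rewrite -[0%R]/(0%:R)%R natZ_eq // mod0n => dvd.
have : logn 2 (4 * m) <= weight k by apply: dvdn_leq_log; lia.
by rewrite logn2_modulus; lia.
Qed.

Lemma weight_period n : n = 0 %[mod 4 * m] -> weight n <= e.
Proof.
rewrite mod0n weight_le => /eqP dvd; have [-> | n_gt0] := posnP n.
  by rewrite logn0 logn2_double.
have : logn 2 (4 * m) <= logn 2 n by apply: dvdn_leq_log.
by rewrite logn2_modulus; lia.
Qed.

(** Since 0 has weight [e], this parity condition says that [a^n] is compatible with the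
    identity. *)
Lemma weight_even_cofactor n :
  0 < n -> ~~ odd (n %/ gcdn (2 * m) n) = (weight n == e).
Proof.
move=> n_gt0; rewrite even_cofactor //; last by lia.
by case: (weight_cases n) => [[_ ? ->]|[[?|?] ->]|[-> ?]]; lia.
Qed.

Lemma weight_eq n k : 0 < n -> 0 < k ->
  logn 2 n = logn 2 k -> logn 2 n <> e -> weight n = weight k.
Proof.
move=> n_gt0 k_gt0.
case: (weight_cases n) => [[_ ? ->]|[[?|?] ->]|[-> ?]];
  by case: (weight_cases k) => [[_ ? ->]|[[?|?] ->]|[-> ?]]; lia.
Qed.

Lemma natZ_gt0 n : n%:R%R != 0%R :> Z -> 0 < n.
Proof. by case: n => [|//]; rewrite eqxx. Qed.

Lemma mod_gt0 n : n <> 0 %[mod 4 * m] -> 0 < n.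
Proof. by case: n. Qed.

Lemma weight_odd r : weight (2 * r + 1) = 0.
Proof. by apply: logn2_odd; lia. Qed.

(** The binary digit of index [v] serves as [g] for both rotations, as [M] puts no condition on
    [g]. *)
Lemma rotations_avoidable (v k l : nat) : v <= e ->
    k%:R%R = M \/ weight k = v -> l%:R%R = M \/ weight l = v ->
  avoidable [set rho k%:R%R; rho l%:R%R].
Proof.
move=> ve kv lv.
have gP (j x : Z) : j \in [set k%:R%R; l%:R%R] -> j != M ->
    odd ((x + (j + M))%R %/ 2 ^ v) = ~~ odd (x %/ 2 ^ v).
  have flip n : n%:R%R = M \/ weight n = v -> n%:R%R != M ->
      odd ((x + (n%:R + M))%R %/ 2 ^ v) = ~~ odd (x %/ 2 ^ v).
    case=> [->|nv _]; first by rewrite eqxx.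
    by rewrite -natrD -nv binary_digit_flip ?nv //; lia.
  by rewrite !inE => /orP[] /eqP->; apply: flip.
have [f fP] := proper_rotations gP.
apply: (avoidable_sub fP) => x; rewrite !inE ?(inj_eq rho_inj) //.
by rewrite !(eq_sym (sigma x)) !(negPf (rho_neq_sigma _ _)).
Qed.

Lemma M_reflection_avoidable c : avoidable [set rho M; sigma c].
Proof.
have [f [g fgP]] := proper_M_reflection m_gt0 c.
apply: (avoidable_sub fgP) => x; rewrite !inE.
  by rewrite (inj_eq rho_inj) (negPf (rho_neq_sigma _ _)) orbF.
by rewrite (inj_eq sigma_inj) eq_sym (negPf (rho_neq_sigma _ _)).
Qed.

(** * Membership in the three blocks *)

Lemma half_modulus x : (x : Z)./2 < 2 * m.
Proof. by have := valZ_lt m_gt0 x; lia. Qed.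

Lemma rho_odd_rotations x : (rho x \in odd_rotations m a) = oddZ x.
Proof.
apply/imsetP/idP => [[i _]|x_odd].
  by rewrite rho_nat => /rho_inj->; rewrite oddZ_nat // oddD oddM.
exists (Ordinal (half_modulus x)) => //; rewrite rho_nat -[in LHS](natr_Zp x) /=.
by congr (rho _%:R%R); have : odd x := x_odd; lia.
Qed.

Lemma sigma_odd_rotations x : (sigma x \in odd_rotations m a) = false.
Proof.
by apply/imsetP => -[i _ /eqP]; rewrite rho_nat eq_sym (negPf (rho_neq_sigma _ _)).
Qed.

Lemma sigma_even_reflections x : (sigma x \in even_reflections m a b) = ~~ oddZ x.
Proof.
apply/imsetP/idP => [[i _]|x_even].
  by rewrite sigma_nat => /sigma_inj->; rewrite oddZ_nat // oddM.
exists (Ordinal (half_modulus x)) => //; rewrite sigma_nat -[in LHS](natr_Zp x) /=.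
by congr (sigma _%:R%R); have : ~~ odd x := x_even; lia.
Qed.

Lemma rho_even_reflections x : (rho x \in even_reflections m a b) = false.
Proof.
by apply/imsetP => -[i _ /eqP]; rewrite sigma_nat (negPf (rho_neq_sigma _ _)).
Qed.

Lemma sigma_odd_reflections x : (sigma x \in odd_reflections m a b) = oddZ x.
Proof.
apply/imsetP/idP => [[i _]|x_odd].
  by rewrite sigma_nat => /sigma_inj->; rewrite oddZ_nat // oddD oddM.
exists (Ordinal (half_modulus x)) => //; rewrite sigma_nat -[in LHS](natr_Zp x) /=.
by congr (sigma _%:R%R); have : odd x := x_odd; lia.
Qed.

Lemma rho_odd_reflections x : (rho x \in odd_reflections m a b) = false.
Proof.
by apply/imsetP => -[i _ /eqP]; rewrite sigma_nat (negPf (rho_neq_sigma _ _)).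
Qed.

Definition in_blocks := (rho_odd_rotations, sigma_odd_rotations,
  sigma_even_reflections, rho_even_reflections, sigma_odd_reflections,
  rho_odd_reflections).


(** * Structure of saturated sets *)

Lemma saturated_avoidable (U : {set gT}) : saturated U -> avoidable U.
Proof. by case/maxsetP. Qed.

Lemma saturated_eq (U V : {set gT}) :
  saturated U -> avoidable V -> U \subset V -> U = V.
Proof. by case/maxsetP=> _ maxU avV /maxU->. Qed.

Lemma rho_of_nat (x : Z) : exists n, x = n%:R%R.
Proof. by exists x; rewrite natr_Zp. Qed.

Lemma even_rho_of_nat (x : Z) : ~~ oddZ x -> exists r, x = (2 * r)%:R%R.
Proof.
move=> x_even; exists x./2; rewrite -[LHS]natr_Zp; congr (_%:R)%R.
by have : ~~ odd x := x_even; lia.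
Qed.

Lemma odd_rho_of_nat (x : Z) : oddZ x -> exists r, x = (2 * r + 1)%:R%R.
Proof.
move=> x_odd; exists x./2; rewrite -[LHS]natr_Zp; congr (_%:R)%R.
by have : odd x := x_odd; lia.
Qed.

(* When the weight is e, adding 2m to r normalises the multiplicity of 2 in 2r
   to that of 4m. *)
Lemma representative (r : nat) : weight (2 * r) <= e -> 0 < 2 * r ->
  exists r', [/\ (2 * r)%:R%R = (2 * r')%:R%R :> Z,
    logn 2 (2 * r') = if weight (2 * r) < e then weight (2 * r) else e.+1
    & logn 2 (2 * r') <> e].
Proof.
move=> wr r_gt0.
have [[_ lt_re ->]|[[r0|gt_re] ->]|[_ gt_w]] := weight_cases (2 * r).
- by exists r; rewrite lt_re; split=> //; lia.
- by lia.
- rewrite ltnn; have [eq_re|ne_re] := eqVneq (logn 2 (2 * r)) e.+1.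
    by exists r; rewrite eq_re; split=> //; lia.
  have rE : 2 * (r + 2 * m) = 4 * m + 2 * r by lia.
  have logr : logn 2 (2 * (r + 2 * m)) = e.+1.
    rewrite rE logn2_add_lt ?logn2_modulus //; first by lia.
    by rewrite ltn_neqAle eq_sym ne_re.
  exists (r + 2 * m); split; [|exact: logr|by rewrite logr; lia].
  by rewrite rE natrD natZ_period // add0r.
- by lia.
Qed.

(** A lone even rotation is not maximal: [rho M] can be joined by a reflection, and any other one by
    [rho M]. *)
Lemma saturated_other (U : {set gT}) (k : Z) : saturated U -> rho k \in U ->
  ~~ oddZ k -> exists2 u, u \in U & u != rho k.
Proof.
move=> satU kU k_even; have avU := saturated_avoidable satU.
case: (pickP [pred u in U | u != rho k]) => [u /andP[]|only]; first by exists u.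
have sub : U \subset [set rho k].
  by apply/subsetP => u uU; have := only u; rewrite !inE uU /= => /negbFE.
have extend V : avoidable V -> rho k \in V -> V \subset U.
  move=> avV kV; rewrite (saturated_eq satU avV) //.
  by apply: subset_trans sub _; rewrite sub1set.
have [kM | kM] := eqVneq k M.
  exists (sigma 0%R); last by rewrite eq_sym rho_neq_sigma.
  apply: (subsetP (extend _ (M_reflection_avoidable 0%R) _)); first by rewrite kM set21.
  by rewrite set22.
exists (rho M); last by rewrite (inj_eq rho_inj) eq_sym.
have [n kn] := rho_of_nat k.
have wn : weight n <= e.
  case/avoidableP: avU => f [g fgP]; rewrite kn in kU kM.
  by apply: (rotation_weight_le m_gt0 fgP); rewrite ?inE.
apply: (subsetP (extend [set rho M; rho k] _ (set22 _ _))); last exact: set21.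
by rewrite kn; apply: (rotations_avoidable wn); [left | right].
Qed.

Local Notation A := (odd_rotations m a).
Local Notation B := (even_reflections m a b).
Local Notation C := (odd_reflections m a b).

Lemma parity_avoidable (p : bool) : avoidable (A :|: if p then C else B).
Proof.
apply: (avoidable_sub (proper_parity m_gt0 p)) => x; case: p;
  by rewrite !inE !in_blocks ?orbF //= ?eqb_id ?eqbF_neg.
Qed.

(** One colour for rotations and the other for reflections: the cosets of the cyclic subgroup
    generated by [a]. *)
Lemma reflections_avoidable : avoidable (B :|: C).
Proof.
have const : proper_colouring set0 [set: Z] (fun=> true) (fun=> false).
  by split=> // k x; rewrite inE.
by apply: (avoidable_sub const) => x; rewrite !inE ?in_blocks.
Qed.

Lemma same_reflection_parity (U : {set gT}) (k c d : Z) : avoidable U ->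
  rho k \in U -> oddZ k -> sigma c \in U -> sigma d \in U -> oddZ c = oddZ d.
Proof.
move=> /avoidableP[f [g fgP]] kU k_odd cU dU.
by apply: (reflections_parity m_gt0 fgP (k := k)); rewrite ?inE.
Qed.

Lemma no_even_rotation_saturated (U : {set gT}) : saturated U ->
    (forall k, rho k \in U -> oddZ k) ->
  [\/ U = A :|: B, U = A :|: C | U = B :|: C].
Proof.
move=> satU U_odd; have avU := saturated_avoidable satU.
have [/existsP[k kU] | noA] := boolP [exists k, rho k \in U]; last first.
  constructor 3; apply: (saturated_eq satU reflections_avoidable).
  apply/subsetP => u uU; case: (coordP u) => -[x ux]; rewrite ux in uU *.
    by move/existsPn: noA => /(_ x); rewrite uU.
  by rewrite !inE !in_blocks orNb.
have [p pP] : exists p, forall c, sigma c \in U -> oddZ c = p.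
  have [/existsP[c cU] | noC] := boolP [exists c, sigma c \in U].
    by exists (oddZ c) => d dU; apply: same_reflection_parity avU kU (U_odd k kU) dU cU.
  (* Without reflections the choice of parity is arbitrary. *)
  by exists true => c cU; move/existsPn: noC => /(_ c); rewrite cU.
have UE : U = A :|: if p then C else B.
  apply: (saturated_eq satU (parity_avoidable p)).
  apply/subsetP => u uU; case: (coordP u) => -[x ux]; rewrite ux in uU *.
    by rewrite inE in_blocks U_odd.
  by rewrite inE in_blocks /= -(pP x uU); case: ifP => x_odd; rewrite in_blocks x_odd.
by rewrite UE; case: (p); [constructor 2 | constructor 1].
Qed.

Lemma even_rotation_unique (U : {set gT}) (k : Z) (u v : gT) : avoidable U ->
  rho k \in U -> ~~ oddZ k -> u \in U -> v \in U -> u != rho k -> v != rho k -> u = v.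
Proof.
move=> avU kU k_even uU vU uk vk; have UE := pair_eq avU kU k_even uU uk.
by move: vU; rewrite UE !inE (negPf vk) => /eqP.
Qed.

(** In an avoidable superset, an even rotation would leave room for only one of [rho 1] and
    [sigma p], and a reflection must share the parity of [sigma p] because [rho 1] is odd. *)
Lemma parity_saturated (p : bool) : saturated (A :|: if p then C else B).
Proof.
apply/maxsetP; split; first exact: parity_avoidable.
move=> V avV sub; apply/eqP; rewrite eqEsubset sub andbT.
have aV : rho 1%R \in V.
  by rewrite (subsetP sub) // inE in_blocks (oddZ_nat m_gt0 1).
have bV : sigma (p : nat)%:R%R \in V.
  by rewrite (subsetP sub) // inE; case: p {sub}; rewrite !in_blocks oddZ_nat.
apply/subsetP => u uV; case: (coordP u) => -[x ux]; rewrite ux in uV *.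
  rewrite inE in_blocks; apply/orP; left; apply/negPn/negP => x_even.
  have /eqP : rho 1%R = sigma (p : nat)%:R%R.
    apply: (even_rotation_unique avV uV x_even aV bV); last first.
      by rewrite eq_sym rho_neq_sigma.
    by rewrite (inj_eq rho_inj) neq_parity // (oddZ_nat m_gt0 1) (negPf x_even).
  by rewrite (negPf (rho_neq_sigma _ _)).
have := same_reflection_parity avV aV (oddZ_nat m_gt0 1) uV bV.
by rewrite oddZ_nat // inE; case: p {sub bV} => /=; rewrite !in_blocks => ->.
Qed.

(** [sigma 0] and [sigma 1] have different parities, which excludes odd rotations, and are distinct,
    which excludes even ones. *)
Lemma reflections_saturated : saturated (B :|: C).
Proof.
apply/maxsetP; split; first exact: reflections_avoidable.
move=> V avV sub; apply/eqP; rewrite eqEsubset sub andbT.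
have reflV x : sigma x \in V.
  by rewrite (subsetP sub) // !inE !in_blocks orNb.
apply/subsetP => u uV; case: (coordP u) => -[x ux]; rewrite ux in uV *; last first.
  by rewrite !inE !in_blocks orNb.
have [x_odd | x_even] := boolP (oddZ x).
  have := same_reflection_parity avV uV x_odd (reflV 0%R) (reflV 1%R).
  by rewrite (oddZ_nat m_gt0 0) (oddZ_nat m_gt0 1).
have /sigma_inj/eqP : sigma 0%R = sigma 1%R.
  by apply: (even_rotation_unique avV uV x_even); rewrite // eq_sym rho_neq_sigma.
by rewrite eq_sym oner_eq0.
Qed.

End QuaternionCoordinates.

(** * The classification *)

Local Open Scope group_scope.

Theorem theorem4p9 (m : nat) (m_gt0 : (0 < m)%N)
    (gT : finGroupType) (a b : gT) (Qm : generalized_quaternion m a b)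
    (U : {set gT}) :
  let A := odd_rotations m a in
  let B := even_reflections m a b in
  let C := odd_reflections m a b in
  saturated U <->
     (exists r : nat,
        (logn 2 (2 * r) <> logn 2 (2 * m) \/ 2 * r = 0 %[mod 4 * m])%N
        /\ U = [set a ^+ (2 * m); a ^+ (2 * r)])
  \/ (* The printed list omits the pairs with an odd power of a, although they
        are saturated: the multiplicities of 2 in 2r+1 and 2m differ. *)
     (exists r : nat, U = [set a ^+ (2 * m); a ^+ (2 * r + 1)])
  \/ (exists r : nat, U = [set a ^+ (2 * m); b * a ^+ r])
  \/ (exists r : nat,
        [/\ (2 * r <> 0 %[mod 4 * m])%N,
            ~~ odd ((2 * r) %/ gcdn (2 * m) (2 * r))
          & U = [set 1; a ^+ (2 * r)]])
  \/ (exists r s : nat,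
        [/\ (2 * r <> 0 %[mod 4 * m] /\ 2 * r <> 2 * m %[mod 4 * m])%N,
            (2 * s <> 0 %[mod 4 * m] /\ 2 * s <> 2 * m %[mod 4 * m])%N,
            (2 * r <> 2 * s %[mod 4 * m])%N,
            (logn 2 (2 * r) = logn 2 (2 * s)
              /\ logn 2 (2 * r) <> logn 2 (2 * m))%N
          & U = [set a ^+ (2 * r); a ^+ (2 * s)]])
  \/ [\/ U = A :|: B, U = A :|: C | U = B :|: C].
Proof.
move=> A B C; have rotE n := rho_nat m_gt0 Qm n; have reflE n := sigma_nat m_gt0 Qm n.
have rotI := rho_inj m_gt0 Qm.
have modE (n k : nat) : ((n%:R)%R == (k%:R)%R :> 'Z_(4 * m)) = (n == k %[mod 4 * m])%N.
  exact: natZ_eq.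
split=> [satU | cases].
  have avU := saturated_avoidable satU.
  have [f [g fgP]] := (avoidableP m_gt0 Qm U).1 avU.
  have weightU n : rho a (n%:R%R : 'Z_(4 * m)) \in U ->
      n%:R%R != (2 * m)%:R%R :> 'Z_(4 * m) ->
      (logn 2 (n + 2 * m) <= logn 2 (2 * m))%N.
    by move=> nU nM; apply: (rotation_weight_le m_gt0 fgP); rewrite ?inE.
  have [/existsP[k /andP[kU k_even]] | noeven] :=
    boolP [exists k : 'Z_(4 * m), (rho a k \in U) && ~~ oddZ k]; last first.
    do 5!right; apply: (no_even_rotation_saturated m_gt0 Qm satU) => k kU.
    by move/existsPn: noeven => /(_ k); rewrite kU /= negbK.
  have [MU | MU] := boolP (rho a ((2 * m)%:R%R : 'Z_(4 * m)) \in U).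
    have M_even : ~~ oddZ ((2 * m)%:R%R : 'Z_(4 * m)) by rewrite oddZM.
    have [u uU uM] := saturated_other m_gt0 Qm satU MU M_even.
    have UE := pair_eq m_gt0 Qm avU MU M_even uU uM.
    have [[l ul]|[c uc]] := coordP m_gt0 Qm u; last first.
      by right; right; left; exists c; rewrite UE uc rotE.
    have [l_odd | l_even] := boolP (oddZ l).
      have [r lr] := odd_rho_of_nat m_gt0 l_odd; rewrite lr in ul.
      by right; left; exists r; rewrite UE ul !rotE.
    have [r lr] := even_rho_of_nat m_gt0 l_even; rewrite lr in ul.
    left; exists r; split; last by rewrite UE ul !rotE.
    (* [weight_le] turns the weight bound into different multiplicities of 2. *)
    left; apply/eqP; rewrite -weight_le // weightU -?ul //.
    by move: uM; rewrite ul (inj_eq rotI).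
  have kM : k != (2 * m)%:R%R by apply: contraNneq MU => <-.
  have [u uU uk] := saturated_other m_gt0 Qm satU kU k_even.
  have UE := pair_eq m_gt0 Qm avU kU k_even uU uk.
  have [[l ul]|[c uc]] := coordP m_gt0 Qm u; last first.
    case/eqP: kM; apply: (even_rotation_reflection m_gt0 fgP (c := c)) => //.
      by rewrite inE.
    by rewrite inE -uc.
  rewrite {u}ul in uU uk UE; rewrite (inj_eq rotI) in uk.
  have lM : l != (2 * m)%:R%R by apply: contraNneq MU => <-.
  have l_even : ~~ oddZ l.
    apply: contra k_even => l_odd.
    by apply: (no_mixed_parity m_gt0 fgP (l := l)); rewrite ?inE.
  (* A partner of the identity has the weight of 0, which is [e]. *)
  have zero_case (r : nat) : rho a (0 : 'Z_(4 * m))%R \in U ->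
      rho a ((2 * r)%:R%R : 'Z_(4 * m)) \in U ->
      (2 * r)%:R%R != 0%R :> 'Z_(4 * m) ->
      (2 * r)%:R%R != (2 * m)%:R%R :> 'Z_(4 * m) ->
      (2 * r <> 0 %[mod 4 * m])%N /\ ~~ odd ((2 * r) %/ gcdn (2 * m) (2 * r)).
    move=> zU rU r0 rM; split; first by move/eqP; rewrite -modE (negPf r0).
    rewrite weight_even_cofactor ?(natZ_gt0 r0) //; apply/eqP/esym.
    have M0 : (0%:R)%R != (2 * m)%:R%R :> 'Z_(4 * m) by rewrite eq_sym M_neq0.
    by apply: (rotations_weight m_gt0 fgP _ M0 _ rM); rewrite inE.
  have [k0 | k0] := eqVneq k 0%R.
    have [r lr] := even_rho_of_nat m_gt0 l_even; rewrite k0 lr in kU uU uk lM UE.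
    do 3!right; left; exists r; have [] := zero_case r kU uU uk lM.
    by split=> //; rewrite UE rotE rho0.
  have [l0 | l0] := eqVneq l 0%R.
    have [r kr] := even_rho_of_nat m_gt0 k_even; rewrite l0 kr in kU uU uk kM UE.
    do 3!right; left; exists r; rewrite eq_sym in uk.
    have [] := zero_case r uU kU uk kM.
    by split=> //; rewrite UE rotE rho0 setUC.
  have [r0 kr] := even_rho_of_nat m_gt0 k_even.
  have [s0 ls] := even_rho_of_nat m_gt0 l_even.
  subst k l.
  have w_eq : logn 2 (2 * r0 + 2 * m) = logn 2 (2 * s0 + 2 * m).
    by apply: (rotations_weight m_gt0 fgP); rewrite ?inE.
  (* Equal weights do not give equal multiplicities when the weight is [e], so both exponents are
     replaced by normalised ones. *)
  have [r [rE logr ne_logr]] := representative m_gt0 (weightU _ kU kM) (natZ_gt0 k0).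
  have [s [sE logs _]] := representative m_gt0 (weightU _ uU lM) (natZ_gt0 l0).
  rewrite rE sE in k0 l0 kM lM uk UE.
  do 4!right; left; exists r, s; split.
  - by split; move/eqP; rewrite -modE; [rewrite (negPf k0) | rewrite (negPf kM)].
  - by split; move/eqP; rewrite -modE; [rewrite (negPf l0) | rewrite (negPf lM)].
  - by move/eqP; rewrite -modE eq_sym (negPf uk).
  - by rewrite {1}logr logs w_eq.
  - by rewrite UE !rotE.
have M_even : ~~ oddZ ((2 * m)%:R%R : 'Z_(4 * m)) by rewrite oddZM.
have M_pair n : (logn 2 (n + 2 * m) <= logn 2 (2 * m))%N ->
    saturated [set a ^+ (2 * m); a ^+ n].
  move=> wn; rewrite !rotE; apply: (pair_saturated m_gt0 Qm M_even).
    by rewrite (inj_eq rotI) weight_M.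
  by apply: (rotations_avoidable m_gt0 Qm wn); [left | right].
have even_pair (r s : nat) : logn 2 (2 * r + 2 * m) = logn 2 (2 * s + 2 * m) ->
    (logn 2 (2 * s + 2 * m) <= logn 2 (2 * m))%N -> (2 * r <> 2 * s %[mod 4 * m])%N ->
    saturated [set a ^+ (2 * r); a ^+ (2 * s)].
  move=> w_eq ws /eqP rs; rewrite !rotE; apply: (pair_saturated m_gt0 Qm).
  - by rewrite oddZ_nat // oddM.
  - by rewrite (inj_eq rotI) modE eq_sym.
  - by apply: (rotations_avoidable m_gt0 Qm ws); right.
case: cases => [[r [log_r ->]]|].
  apply: M_pair; rewrite weight_le //; case: log_r => [/eqP //|].
  by rewrite -weight_le //; apply: weight_period.
case=> [[r ->]|]; first by apply: M_pair; rewrite weight_odd.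
case=> [[r ->]|].
  rewrite rotE reflE; apply: (pair_saturated m_gt0 Qm M_even).
    by rewrite eq_sym rho_neq_sigma.
  exact: M_reflection_avoidable.
case=> [[r [r_neq0 r_even ->]]|].
  have /eqP w_r : logn 2 (2 * r + 2 * m) == logn 2 (2 * m).
    by rewrite -weight_even_cofactor ?(mod_gt0 r_neq0).
  (* The identity is treated as [a ^+ (2 * 0)], of weight [e]. *)
  rewrite -(expg0 a) -(muln0 2); apply: even_pair; rewrite ?w_r ?muln0 //.
  exact: nesym.
case=> [[r [s [[r0 rM] [s0 sM] rs [log_eq log_ne] ->]]]|].
  apply: even_pair; last exact: rs; last by rewrite weight_le // -log_eq; apply/eqP.
  by apply: weight_eq; rewrite ?(mod_gt0 r0) ?(mod_gt0 s0).
by case=> ->; [apply: (parity_saturated m_gt0 Qm false)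
  | apply: (parity_saturated m_gt0 Qm true) | apply: reflections_saturated].
Qed.
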